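(* Let $f=\frac1n\sum_{i=1}^n f^{(i)}$ with $f^{(i)}:\mathbb{R}^d\to\mathbb{R}$, let $r:\mathbb{R}^d\to\mathbb{R}\cup\{+\infty\}$, and let $P=f+r$. Suppose that each $f^{(i)}$ is $L_i$-smooth, that $r$ is convex and closed, and that $P^\star:=\min_{x\in\mathbb{R}^d}P(x)>-\infty$. Suppose that for some $a\in(0,1)$, $b\in[0,1]$ and $c\ge 0$ the delays satisfy $$\tau_k:=\max_{i\in\{1,\dots,n\}}\tau_k^{(i)}\le \min(k,\;ak^b+c),\qquad \forall k\in\mathbb{N}_0 .$$ Define $L=\sqrt{\frac1n\sum_{i=1}^nL_i^2}$. Let $\{x_k\}$ be generated by the PIAG algorithm (defined in the context) with step-sizes $$\gamma_k=\frac{h}{L\left(a\left(\frac{k+c}{1-a}\right)^b+c+1\right)},\qquad \forall k\in\mathbb{N}_0,$$ where $h\in(0,1)$. Let $\phi(k)=k^{1-b}$ if $b\in[0,1)$ and $\phi(k)=\ln k$ if $b=1$. Then, as $k\to\infty$: (i) There exist $\xi_k\in\partial r(x_k)$, $k\in\mathbb{N}_0$, such that $\min_{t\le k}\|\nabla f(x_t)+\xi_t\|^2=O(1/\phi(k))$. (ii) If each $f^{(i)}$ is convex, then $P(x_k)-P^\star=O(1/\phi(k))$. (iii) If $P$ satisfies the proximal PL condition (defined in the context) for some $\sigma>0$, then $P(x_k)-P^\star=O(\lambda^{\phi(k)})$ for some $\lambda\in(0,1)$.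
   Context: $\mathbb{N}_0=\{0,1,2,\dots\}$; $\|\cdot\|$ is the Euclidean norm; $\partial r$ is the convex subdifferential. A differentiable function $f$ on $\mathbb{R}^d$ is $L$-smooth if $\|\nabla f(x)-\nabla f(x+v)\|\le L\|v\|$ for all $x,v\in\mathbb{R}^d$. The proximal operator is $\operatorname{prox}_{r}(x)=\arg\min_{y\in\mathbb{R}^d}\{r(y)+\frac12\|y-x\|^2\}$. PIAG (proximal incremental aggregated gradient) algorithm: starting from an initial iterate $x_0$, for $k\in\mathbb{N}_0$, $$g_k=\frac1n\sum_{i=1}^n\nabla f^{(i)}(x_{k-\tau_k^{(i)}}),\qquad x_{k+1}=\operatorname{prox}_{\gamma_k r}(x_k-\gamma_kg_k),$$ where $\tau_k^{(i)}\in\{0,1,\dots,k\}$ is the delay of the gradient of $f^{(i)}$ at iteration $k$ and $\gamma_k\ge0$ is the step-size. Proximal PL condition for $\sigma>0$ (with $f$ being $L$-smooth, $r$ convex, $P=f+r$): $$\sigma(P(x)-P^\star)\le -L\hat P(x)\quad\forall x\in\operatorname{dom}(P),$$ where $P^\star=\min_{x\in\mathbb{R}^d} P(x)$ and $$\hat P(x)=\min_{y\in\mathbb{R}^d}\left\{\langle\nabla f(x),y-x\rangle+\frac L2\|y-x\|^2+r(y)-r(x)\right\}.$$ In the claim, $L$ in this condition is the constant $L=\sqrt{\frac1n\sum_iL_i^2}$, for which $f$ is $L$-smooth.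
   Formalization: In (i), ξ_0 ∈ ∂r(x_0) is required only if ∂r(x_0) is nonempty (for arbitrary x_0 it may be empty, making the claim false), and the bound is proved for the minimum over 1 ≤ t ≤ k, which is stronger; L > 0 is assumed so that γ_k is defined. *)

(* Defs.v *)
From HB Require Import structures.
From mathcomp Require Import all_boot all_order all_algebra.
From mathcomp Require Import all_classical all_reals all_analysis.
Import Order.TTheory GRing.Theory Num.Theory.
Import numFieldNormedType.Exports.

Set Implicit Arguments.
Unset Strict Implicit.
Unset Printing Implicit Defensive.

Local Open Scope classical_set_scope.
Local Open Scope ring_scope.

Definition dotv (R : realType) (d : nat) (u v : 'rV[R]_d) : R :=
  \sum_(j < d) u 0 j * v 0 j.

(* The library norm `|v| on 'rV[R]_d is the sup norm; it is used only through
   the (norm-independent) notions of differentiability and closedness. *)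
Definition enorm (R : realType) (d : nat) (v : 'rV[R]_d) : R :=
  Num.sqrt (dotv v v).

Definition grad (R : realType) (d : nat) (f : 'rV[R]_d -> R) (x : 'rV[R]_d) :
    'rV[R]_d :=
  \row_(j < d) 'D_(delta_mx 0 j) (f : 'rV[R]_d -> R^o) x.

Definition smooth (R : realType) (d : nat) (L : R) (f : 'rV[R]_d -> R) : Prop :=
  (forall x, differentiable (f : 'rV[R]_d -> R^o) x) /\
  (forall x v, enorm (grad f x - grad f (x + v)) <= L * enorm v).

Section extended_valued_functions.
Local Open Scope ereal_scope.

(* With the conventions 0 * +oo = 0 and r > -oo, the endpoints t = 0, 1 add no
   constraint. *)
Definition econvex (R : realType) (d : nat) (r : 'rV[R]_d -> \bar R) : Prop :=
  forall (x y : 'rV[R]_d) (t : R), (0 <= t <= 1)%R ->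
    r (t *: x + (1 - t) *: y)%R <= t%:E * r x + (1 - t)%:E * r y.

(* closed epigraph *)
Definition eclosed (R : realType) (d : nat) (r : 'rV[R]_d -> \bar R) : Prop :=
  closed [set p : 'rV[R]_d * R^o | r p.1 <= (p.2 : R)%:E].

Definition argmin (R : realType) (T : Type) (F : T -> \bar R) : set T :=
  [set y | forall z, F y <= F z].

Definition prox (R : realType) (d : nat) (r : 'rV[R]_d -> \bar R)
    (x : 'rV[R]_d) : set 'rV[R]_d :=
  argmin (fun y => r y + (2^-1 * enorm (y - x) ^+ 2)%:E).

Definition subdiff (R : realType) (d : nat) (r : 'rV[R]_d -> \bar R)
    (x : 'rV[R]_d) : set 'rV[R]_d :=
  [set xi | r x \is a fin_num /\
            forall y, r x + (dotv xi (y - x))%:E <= r y].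

Definition Phat (R : realType) (d : nat) (L : R) (f : 'rV[R]_d -> R)
    (r : 'rV[R]_d -> \bar R) (x : 'rV[R]_d) : \bar R :=
  ereal_inf (range (fun y : 'rV[R]_d =>
    (dotv (grad f x) (y - x) + L / 2 * enorm (y - x) ^+ 2)%:E + r y - r x)).

Definition proxPL (R : realType) (d : nat) (sigma L : R) (f : 'rV[R]_d -> R)
    (r : 'rV[R]_d -> \bar R) (Pstar : R) : Prop :=
  forall x, (f x)%:E + r x < +oo ->
    sigma%:E * ((f x)%:E + r x - Pstar%:E) <= - (L%:E * Phat L f r x).

(* u = O(v) for an extended-real sequence: u is eventually finite, and its
   real values are O(v). *)
Definition ebigO (R : realType) (u : nat -> \bar R) (v : nat -> R) : Prop :=
  (\forall k \near \oo, u k \is a fin_num) /\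
  (fun k => fine (u k) : R^o) =O_\oo (fun k => v k : R^o).

End extended_valued_functions.

Definition favg (R : realType) (d n : nat) (f : 'I_n -> 'rV[R]_d -> R) :
    'rV[R]_d -> R :=
  fun x => n%:R^-1 * \sum_(i < n) f i x.

(* tau i k is the delay of the gradient of f i at iteration k; it is meant to
   satisfy tau i k <= k, so that the subtraction is not truncated. *)
Definition aggr_grad (R : realType) (d n : nat) (f : 'I_n -> 'rV[R]_d -> R)
    (tau : 'I_n -> nat -> nat) (x : nat -> 'rV[R]_d) (k : nat) : 'rV[R]_d :=
  n%:R^-1 *: \sum_(i < n) grad (f i) (x (k - tau i k)%N).

Definition PIAG (R : realType) (d n : nat) (f : 'I_n -> 'rV[R]_d -> R)
    (r : 'rV[R]_d -> \bar R) (tau : 'I_n -> nat -> nat) (gamma : nat -> R)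
    (x : nat -> 'rV[R]_d) : Prop :=
  forall k, prox (fun y => (gamma k)%:E * r y)%E
                 (x k - gamma k *: aggr_grad f tau x k) (x k.+1).

(* At b = 0 the library convention 0 `^ 0 = 1 applies. *)
Definition stepsize (R : realType) (L a b c h : R) (k : nat) : R :=
  h / (L * (a * ((k%:R + c) / (1 - a)) `^ b + c + 1)).

Definition phi (R : realType) (b : R) (k : nat) : R :=
  if b == 1 then ln k%:R else k%:R `^ (1 - b).

(* minimum of F 1, ..., F k, for k >= 1 *)
Definition min_upto (R : realType) (F : nat -> R) (k : nat) : R :=
  \big[Num.min/F 1%N]_(1 <= t < k.+1) F t.

(* Main.v *)
(* Write s_k = |x_{k+1} - x_k|, w_k = s_k^2 / gamma_k and H = h / L.  The delay
   bound makes the step-sizes of each window [k - tau_k, k] sum up to at most H,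
   so that the error of the aggregated gradient, at most L times the sum of the
   s_j over the window, is controlled through Cauchy-Schwarz by the w_j in the
   window.  Adding L / 2 times a potential that charges each w_j with the
   step-sizes of the future windows that may still contain j turns P - P* into
   a Lyapunov function V with V_{k+1} <= V_k - (1 - h) w_k.  In each case the
   quantity of interest e_k satisfies
     gamma_k e_{k+1} <= telescoping terms + O(w_k) + O(gamma_k (sum of the w_j)),
   whose right-hand side is absorbed by V and the potential; the rates in the
   sum of the step-sizes follow, and this sum is at least of order phi(k).
   As r(x_0) may be infinite, all the estimates start at k = 1. *)

Require Import Defs.
From HB Require Import structures.
From mathcomp Require Import all_boot all_order all_algebra.
From mathcomp Require Import all_classical all_reals all_analysis.
From mathcomp Require Import ring lra.
Import Order.TTheory GRing.Theory Num.Theory.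
Import numFieldNormedType.Exports.

Set Implicit Arguments.
Unset Strict Implicit.
Unset Printing Implicit Defensive.

Local Open Scope classical_set_scope.
Local Open Scope ring_scope.

(** * Lyapunov analysis under a bounded-window condition *)

Section delay_window.
Context {R : realType}.
Variables (H : R) (gamma s : nat -> R) (m : nat -> nat).
Hypothesis gamma_gt0 : forall k, 0 < gamma k.
Hypothesis m_le : forall k, (m k <= k)%N.
Hypothesis window : forall k, \sum_(m k <= t < k.+1) gamma t <= H.

Let w k := s k ^+ 2 / gamma k.
Let S k := \sum_(m k <= j < k) s j.
Let W k := \sum_(m k <= j < k) w j.

Let gamma_ge0 k : 0 <= gamma k.
Proof. exact: ltW. Qed.

Let w_ge0 k : 0 <= w k.
Proof. by rewrite /w divr_ge0 ?sqr_ge0// ltW. Qed.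

Let sE k : s k ^+ 2 = gamma k * w k.
Proof. by rewrite /w mulrC divfK// gt_eqF. Qed.

Let W_ge0 k : 0 <= W k.
Proof. by apply: sumr_ge0. Qed.

Let window' k : \sum_(m k <= t < k) gamma t <= H - gamma k.
Proof. by have := window k; rewrite big_nat_recr//=; lra. Qed.

Lemma window_step_le k : gamma k <= H.
Proof.
have : 0 <= \sum_(m k <= t < k) gamma t by apply: sumr_ge0 => t _; exact: ltW.
by have := window' k; lra.
Qed.

Let cross j k : 2 * (s j * s k) <= gamma j * w k + gamma k * w j.
Proof.
have gj := gamma_gt0 j; have gk := gamma_gt0 k.
rewrite -subr_ge0; have -> : gamma j * w k + gamma k * w j - 2 * (s j * s k) =
  (gamma j * s k - gamma k * s j) ^+ 2 / (gamma j * gamma k).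
  by rewrite /w; field; rewrite !gt_eqF.
by rewrite divr_ge0 ?sqr_ge0// mulr_ge0// ltW.
Qed.

Lemma sum_cross_le i n k :
  2 * ((\sum_(i <= j < n) s j) * s k) <=
  (\sum_(i <= j < n) gamma j) * w k + gamma k * \sum_(i <= j < n) w j.
Proof.
rewrite mulr_suml mulr_sumr mulr_suml mulr_sumr -big_split/=.
by apply: ler_sum => j _; exact: cross.
Qed.

Lemma sqr_sum_le i n :
  (\sum_(i <= j < n) s j) ^+ 2 <=
  (\sum_(i <= j < n) gamma j) * (\sum_(i <= j < n) w j).
Proof.
have [ni|] := leqP n i; first by rewrite !big_geq// expr0n/= mulr0.
elim: n => // n IH; rewrite ltnS leq_eqVlt => /predU1P[->|lt_in].
  by rewrite !big_nat1 sE.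
have {}IH := IH lt_in; have lin := ltnW lt_in.
rewrite !(big_nat_recr n i)//=.
have := sum_cross_le i n n; have := sE n.
move: (\sum_(i <= _ < n) s _) (\sum_(i <= _ < n) gamma _) IH => a b.
move: (\sum_(i <= _ < n) w _) => c; nra.
Qed.

Lemma window_cross_le k :
  2 * (S k * s k) <= (H - gamma k) * w k + gamma k * W k.
Proof.
apply: le_trans (sum_cross_le _ _ _) _.
by rewrite lerD2r ler_wpM2r.
Qed.

Lemma window_sqrS_le k : (S k + s k) ^+ 2 <= H * (W k + w k).
Proof.
have := sqr_sum_le (m k) k.+1; rewrite !big_nat_recr//=.
rewrite -/(S k) -/(W k) => /le_trans; apply.
apply: ler_wpM2r; first by rewrite addr_ge0.
by have := window' k; lra.
Qed.

Let B k j := Num.max 0 (H - \sum_(j <= t < k) gamma t).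

(* [B k j] bounds the total step-size of the iterations [t >= k] whose window
   still contains [j]; [potential k] is thus the delayed error still to come. *)
Definition potential k : R := \sum_(0 <= j < k) w j * B k j.

Lemma potential_ge0 k : 0 <= potential k.
Proof. by apply: sumr_ge0 => j _; rewrite mulr_ge0// le_max lexx. Qed.

Let BSk k : B k.+1 k = H - gamma k.
Proof.
by rewrite /B big_nat1; apply/max_idPr; rewrite subr_ge0 window_step_le.
Qed.

Let potentialS k :
  potential k.+1 = \sum_(0 <= j < k) w j * B k.+1 j + w k * (H - gamma k).
Proof. by rewrite /potential big_nat_recr//= BSk. Qed.

Let BS k j : (j <= k)%N -> B k.+1 j = Num.max 0 (B k j - gamma k).
Proof.
move=> jk; rewrite /B big_nat_recr//=; have := gamma_gt0 k.
by rewrite /Order.max; do !case: ifPn; rewrite -?leNgt; lra.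
Qed.

Let sumr_ge_le_nat (F : nat -> R) i j n : (i <= j)%N ->
  (forall k, 0 <= F k) ->
  \sum_(j <= k < n) F k <= \sum_(i <= k < n) F k.
Proof.
move=> ij F0; have [jn|nj] := leqP j n.
  by rewrite (big_cat_nat ij jn)/= lerDr sumr_ge0.
by rewrite (big_geq (ltnW nj)) sumr_ge0.
Qed.

Lemma potential_step k :
  potential k.+1 <= potential k + (H - gamma k) * w k - gamma k * W k.
Proof.
rewrite potentialS /potential /W.
rewrite !(big_cat_nat (leq0n _) (m_le k))/=.
have h1 : \sum_(0 <= j < m k) w j * B k.+1 j <= \sum_(0 <= j < m k) w j * B k j.
  rewrite !big_nat; apply: ler_sum => j /andP[_ jm]; apply: ler_wpM2l => //.
  rewrite BS ?(leq_trans (ltnW jm))//.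
  have : 0 <= B k j by rewrite le_max lexx.
  by have := gamma_gt0 k; rewrite /Order.max; case: ifP; lra.
have h2 : \sum_(m k <= j < k) w j * B k.+1 j <=
    \sum_(m k <= j < k) w j * B k j - gamma k * \sum_(m k <= j < k) w j.
  rewrite mulr_sumr -sumrB !big_nat; apply: ler_sum => j /andP[mj jk].
  rewrite (mulrC (gamma k)) -mulrBr; apply: ler_wpM2l => //.
  have le1 : \sum_(j <= t < k.+1) gamma t <= H.
    apply: le_trans (window k); apply: sumr_ge_le_nat => // i; exact: ltW.
  have le2 : H - \sum_(j <= t < k) gamma t <= B k j by rewrite le_max lexx orbT.
  move: le1; rewrite BS ?(ltnW jk)// big_nat_recr ?(ltnW jk)//=.
  by rewrite /Order.max; case: ifP; lra.
by rewrite (mulrC (H - _)); lra.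
Qed.

Lemma potential_contract k :
  gamma k * potential k <= H * (potential k - potential k.+1 + H * w k).
Proof.
have H0 : 0 <= H by apply: le_trans (window_step_le 0); exact: ltW.
have h : gamma k * potential k <=
    H * (potential k - \sum_(0 <= j < k) w j * B k.+1 j).
  rewrite /potential -sumrB !mulr_sumr !big_nat; apply: ler_sum => j.
  move=> /andP[_ jk]; rewrite -mulrBr !(mulrCA _ (w j)); apply: ler_wpM2l => //.
  rewrite BS ?(ltnW jk)//.
  have B0 : 0 <= B k j by rewrite le_max lexx.
  have BH : B k j <= H.
    rewrite ge_max H0/= gerBl sumr_ge0// => i _; exact: ltW.
  have gH := window_step_le k; have g0 := gamma_gt0 k.
  by rewrite /Order.max; case: ifPn => ?; nra.
apply: le_trans h _; apply: ler_wpM2l => //; rewrite potentialS.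
by have : 0 <= w k * gamma k by [rewrite mulr_ge0// ltW]; lra.
Qed.

Section rates.
Variables (L h : R) (F : nat -> R).
Hypothesis L_gt0 : 0 < L.
Hypothesis h01 : 0 < h < 1.
Hypothesis LH : L * H = h.
Hypothesis F_ge0 : forall k, (0 < k)%N -> 0 <= F k.
Hypothesis descent : forall k, (0 < k)%N ->
  F k.+1 <= F k + L * (S k * s k) + L / 2 * s k ^+ 2 - w k.

Let V k := F k + L / 2 * potential k.

Let H_gt0 : 0 < H.
Proof. exact: lt_le_trans (window_step_le 0). Qed.

Let H_ge0 : 0 <= H. Proof. exact: ltW. Qed.

Let L_ge0 : 0 <= L. Proof. exact: ltW. Qed.

Let h_lt1 : 0 < 1 - h.
Proof. by case/andP: h01; rewrite subr_gt0. Qed.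

Let V_ge0 k : (0 < k)%N -> 0 <= V k.
Proof.
by move=> k0; rewrite addr_ge0 ?F_ge0// mulr_ge0 ?potential_ge0// divr_ge0.
Qed.

Let lyapunov_step k : (0 < k)%N -> V k.+1 <= V k - (1 - h) * w k.
Proof.
move=> k0; have := descent k0; have := potential_step k.
have := window_cross_le k; have := sE k; rewrite /V -LH.
have : 0 <= L * gamma k * w k by rewrite mulr_ge0// mulr_ge0.
move: (potential k.+1) (potential k) (F k.+1) (F k) (S k * s k) (W k) (w k).
move=> U1 U0 F1 F0 c W0 w0. move=> h1 -> h2 h3 h4.
have : 0 <= L * (((H - gamma k) * w0 + gamma k * W0) - 2 * c).
  by rewrite mulr_ge0// subr_ge0.
have : 0 <= L * (U0 + (H - gamma k) * w0 - gamma k * W0 - U1).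
  by rewrite mulr_ge0// subr_ge0.
lra.
Qed.

Let V_nincr i n : (0 < i)%N -> (i <= n)%N -> V n <= V i.
Proof.
move=> i0; elim: n => [|n IH]; first by rewrite leqn0 => /eqP i_0; rewrite i_0 in i0.
rewrite leq_eqVlt => /predU1P[->//|]; rewrite ltnS => lin.
apply: le_trans (IH lin); apply: le_trans (lyapunov_step _) _.
  exact: leq_trans lin.
by rewrite gerBl mulr_ge0// ltW.
Qed.

Let energy (G T : nat -> R) (c1 c2 : R) : 0 <= c1 -> 0 <= c2 ->
  (forall k, (0 < k)%N ->
    gamma k * G k.+1 <= T k - T k.+1 + c1 * w k + c2 * (gamma k * W k)) ->
  exists q M : R, [/\ 0 <= q, 0 < M &
    let E k := T k + q * potential k + M * V k in
    forall k, (0 < k)%N -> gamma k * G k.+1 <= E k - E k.+1].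
Proof.
move=> c10 c20 hG.
exists c2, ((c1 + c2 * H + 1) / (1 - h)); split => //.
  by rewrite divr_gt0// ltr_wpDl// addr_ge0// mulr_ge0.
move=> E k k0; apply: le_trans (hG k k0) _; rewrite /E.
have hU := potential_step k.
have : 0 <= c2 * (potential k + (H - gamma k) * w k - gamma k * W k
   - potential k.+1) by rewrite mulr_ge0// subr_ge0.
have : 0 <= c2 * gamma k * w k by rewrite mulr_ge0// mulr_ge0.
have : (c1 + c2 * H + 1) * w k <=
    (c1 + c2 * H + 1) / (1 - h) * (V k - V k.+1).
  rewrite mulrAC ler_pdivlMr// -mulrA; apply: ler_wpM2l.
    by rewrite !addr_ge0// mulr_ge0.
  by have := lyapunov_step k0; lra.
have := w_ge0 k; lra.
Qed.

Let telescope_le (G E : nat -> R) mu n : (0 < n)%N ->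
  (forall k, (0 < k)%N -> gamma k * G k.+1 <= E k - E k.+1) -> 0 <= E n ->
  (forall t, (0 < t <= n)%N -> mu <= G t) ->
  mu * (\sum_(1 <= t < n) gamma t) <= E 1%N.
Proof.
move=> n0 hE En hmu.
apply: (@le_trans _ _ (\sum_(1 <= t < n) (E t - E t.+1))).
  rewrite mulr_sumr !big_nat; apply: ler_sum => t /andP[t1 tn].
  apply: le_trans (hE t t1); rewrite mulrC; apply: ler_wpM2l => //.
  by rewrite hmu//= tn.
have -> : \sum_(1 <= t < n) (E t - E t.+1) = E 1%N - E n.
  rewrite -(opprB (E n)) -telescope_sumr//.
  by rewrite -sumrN; apply: eq_bigr => k _; rewrite opprB.
by rewrite gerBl.
Qed.

Lemma best_iterate_rate (G : nat -> R) (c1 c2 : R) : 0 <= c1 -> 0 <= c2 ->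
  (forall k, (0 < k)%N ->
    gamma k * G k.+1 <= c1 * w k + c2 * (gamma k * W k)) ->
  exists2 C : R, 0 <= C & forall n mu, (0 < n)%N ->
    (forall t, (0 < t <= n)%N -> mu <= G t) ->
    mu * (\sum_(1 <= t < n) gamma t) <= C.
Proof.
move=> c10 c20 hG.
have [|q [M [q0 M0 hE]]] := energy (T := fun=> 0) (G := G) c10 c20.
  by move=> k k0; rewrite subrr add0r hG.
have E0 n : (0 < n)%N -> 0 <= 0 + q * potential n + M * V n.
  move=> n0; rewrite add0r addr_ge0// mulr_ge0 ?potential_ge0 ?V_ge0//.
  exact: ltW.
exists (0 + q * potential 1 + M * V 1%N); first exact: E0.
by move=> n mu n0; apply: (telescope_le n0 hE); exact: E0.
Qed.

Let energy_lyapunov (T : nat -> R) (c1 c2 : R) : 0 <= c1 -> 0 <= c2 ->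
  (forall k, (0 < k)%N ->
    gamma k * F k.+1 <= T k - T k.+1 + c1 * w k + c2 * (gamma k * W k)) ->
  exists q M : R, [/\ 0 <= q, 0 < M &
    let E k := T k + q * potential k + M * V k in
    forall k, (0 < k)%N -> gamma k * V k.+1 <= E k - E k.+1].
Proof.
move=> c10 c20 hF; set e := L / 2 * H.
have e0 : 0 <= e by rewrite mulr_ge0// divr_ge0.
have [||q [M [q0 M0 hE]]] := @energy (fun k => V k)
  (fun k => T k + e * potential k) (c1 + 2 * e * H) c2 _ c20.
- by rewrite addr_ge0// mulr_ge0// mulr_ge0.
- move=> k k0; have := hF k k0.
  have U1 := potential_step k; have U2 := potential_contract k.
  have a1 : 0 <= gamma k * (gamma k * w k) by rewrite mulr_ge0// mulr_ge0.
  have a2 : 0 <= gamma k * (gamma k * W k) by rewrite mulr_ge0// mulr_ge0.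
  have a3 : gamma k * (H * w k) <= H * (H * w k).
    by apply: ler_wpM2r; [rewrite mulr_ge0|exact: window_step_le].
  have : gamma k * potential k.+1 <= H * (potential k - potential k.+1 + 2 * H * w k).
    have := ler_wpM2l (gamma_ge0 k) U1; lra.
  move=> /(ler_wpM2l (divr_ge0 L_ge0 (ler0n _ 2))).
  rewrite /V /e; lra.
exists (e + q), M; split => //; first by rewrite addr_ge0.
by move=> E k k0; have := hE k k0; rewrite /E; lra.
Qed.

Lemma last_iterate_rate (D : nat -> R) (c1 c2 : R) : 0 <= c1 -> 0 <= c2 ->
  (forall k, 0 <= D k) ->
  (forall k, (0 < k)%N ->
    gamma k * F k.+1 <= D k - D k.+1 + c1 * w k + c2 * (gamma k * W k)) ->
  exists2 C : R, 0 <= C & forall n, (0 < n)%N ->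
    F n * (\sum_(1 <= t < n) gamma t) <= C.
Proof.
move=> c10 c20 D0 hF.
have [q [M [q0 M0 hE]]] := energy_lyapunov c10 c20 hF.
have E0 n : (0 < n)%N -> 0 <= D n + q * potential n + M * V n.
  move=> n0; rewrite !addr_ge0// mulr_ge0 ?potential_ge0 ?V_ge0//.
  exact: ltW.
exists (D 1%N + q * potential 1 + M * V 1%N); first exact: E0.
move=> n n0; apply: (@le_trans _ _ (V n * \sum_(1 <= t < n) gamma t)).
  apply: ler_wpM2r; first exact: sumr_ge0.
  by rewrite lerDl mulr_ge0 ?potential_ge0// divr_ge0.
apply: (telescope_le (G := fun k => V k) n0 hE); first exact: E0.
by move=> t /andP[t0 tn]; exact: V_nincr.
Qed.

Lemma last_iterate_linear_rate (c1 c2 : R) : 0 <= c1 -> 0 <= c2 ->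
  (forall k, (0 < k)%N ->
    gamma k * F k.+1 <= c1 * w k + c2 * (gamma k * W k)) ->
  exists2 C : R, 0 <= C & exists2 delta : R, 0 < delta & forall n, (0 < n)%N ->
    F n <= C * expR (- (delta * \sum_(1 <= t < n) gamma t)).
Proof.
move=> c10 c20 hF.
have [|q [M [q0 M0 hE]]] := energy_lyapunov (T := fun=> 0) c10 c20.
  by move=> k k0; rewrite subrr add0r hF.
pose E k := q * potential k + M * V k.
have E0 n : (0 < n)%N -> 0 <= E n.
  move=> n0; rewrite addr_ge0// mulr_ge0 ?potential_ge0 ?V_ge0//.
  exact: ltW.
pose N := q * (2 / L) + M; have N0 : 0 < N.
  by rewrite ltr_wpDl// mulr_ge0// divr_ge0.
have EV k : (0 < k)%N -> E k <= N * V k.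
  move=> k0; rewrite /E /N mulrDl lerD2r -mulrA; apply: ler_wpM2l => //.
  rewrite mulrAC ler_pdivlMr// /V; have := F_ge0 k0; lra.
pose delta := (N + H)^-1.
have delta0 : 0 < delta by rewrite invr_gt0 addr_gt0.
have Estep k : (0 < k)%N -> E k.+1 <= E k * expR (- (delta * gamma k)).
  move=> k0; have := hE k k0; rewrite !add0r -/(E k) -/(E k.+1) => hk.
  have g0 := gamma_gt0 k; have gH := window_step_le k.
  have NE : gamma k * E k.+1 <= N * (E k - E k.+1).
    apply: (@le_trans _ _ (gamma k * (N * V k.+1))).
      by apply: ler_wpM2l => //; exact: EV.
    by rewrite mulrCA; apply: ler_wpM2l => //; exact: ltW.
  have E1 := E0 k.+1 isT; have Ek := E0 k k0.
  have NH0 : 0 < N + H by rewrite addr_gt0.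
  apply: (@le_trans _ _ (E k * (1 - delta * gamma k))); last first.
    by apply: ler_wpM2l => //; have := expR_ge1Dx (- (delta * gamma k)).
  have -> : E k * (1 - delta * gamma k) = (E k * (N + H - gamma k)) / (N + H).
    by rewrite /delta; field; rewrite gt_eqF.
  have dE : 0 <= E k - E k.+1.
    by rewrite -(pmulr_rge0 _ N0); apply: le_trans NE; rewrite mulr_ge0.
  have : 0 <= (H - gamma k) * (E k - E k.+1) by rewrite mulr_ge0// subr_ge0.
  by rewrite ler_pdivlMr//; lra.
exists (E 1%N / M); first by rewrite divr_ge0 ?E0// ltW.
exists delta => // n n0; rewrite mulrAC ler_pdivlMr//.
apply: (@le_trans _ _ (E n)).
  rewrite mulrC /E; apply: (@le_trans _ _ (M * V n)); last first.
    by rewrite lerDr mulr_ge0// potential_ge0.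
  apply: ler_wpM2l; first exact: ltW.
  by rewrite lerDl mulr_ge0 ?potential_ge0// divr_ge0.
elim: n n0 => // -[_ _|n IH _]; first by rewrite big_geq// mulr0 oppr0 expR0 mulr1.
apply: le_trans (Estep _ _) _ => //.
rewrite big_nat_recr//= mulrDr opprD expRD mulrA.
by apply: ler_wpM2r (IH _); rewrite ?expR_ge0.
Qed.

End rates.
End delay_window.

(** * Euclidean geometry and gradients *)

Section euclidean.
Context {R : realType} {d : nat}.
Implicit Types u v z : 'rV[R]_d.

Lemma dotvC u v : dotv u v = dotv v u.
Proof. by apply: eq_bigr => j _; rewrite mulrC. Qed.

Lemma dotvDl u v z : dotv (u + v) z = dotv u z + dotv v z.
Proof. by rewrite /dotv -big_split/=; apply: eq_bigr => j _; rewrite mxE mulrDl. Qed.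

Lemma dotvZl k u v : dotv (k *: u) v = k * dotv u v.
Proof. by rewrite /dotv mulr_sumr; apply: eq_bigr => j _; rewrite mxE mulrA. Qed.

Lemma dotvNl u v : dotv (- u) v = - dotv u v.
Proof. by rewrite -scaleN1r dotvZl mulN1r. Qed.

Lemma dotvBl u v z : dotv (u - v) z = dotv u z - dotv v z.
Proof. by rewrite dotvDl dotvNl. Qed.

Lemma dotvDr u v z : dotv z (u + v) = dotv z u + dotv z v.
Proof. by rewrite !(dotvC z) dotvDl. Qed.

Lemma dotvZr k u v : dotv u (k *: v) = k * dotv u v.
Proof. by rewrite !(dotvC u) dotvZl. Qed.

Lemma dotvBr u v z : dotv z (u - v) = dotv z u - dotv z v.
Proof. by rewrite !(dotvC z) dotvBl. Qed.

Lemma dotvNr u v : dotv u (- v) = - dotv u v.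
Proof. by rewrite !(dotvC u) dotvNl. Qed.

Lemma dotv_suml (I : Type) (s : seq I) (F : I -> 'rV[R]_d) v :
  dotv (\sum_(i <- s) F i) v = \sum_(i <- s) dotv (F i) v.
Proof.
elim: s => [|i s IH]; last by rewrite !big_cons dotvDl IH.
by rewrite !big_nil -(scale0r 0) dotvZl mul0r.
Qed.

Lemma dotvv_ge0 v : 0 <= dotv v v.
Proof. by apply: sumr_ge0 => j _; rewrite -expr2 sqr_ge0. Qed.

Lemma enorm_ge0 v : 0 <= enorm v.
Proof. exact: sqrtr_ge0. Qed.

Lemma enorm_sqr v : enorm v ^+ 2 = dotv v v.
Proof. exact/sqr_sqrtr/dotvv_ge0. Qed.

Lemma enorm_eq0 v : enorm v = 0 -> v = 0.
Proof.
move=> v0; have : dotv v v = 0 by rewrite -enorm_sqr v0 expr0n.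
move/psumr_eq0P => h; apply/rowP => j; rewrite mxE; apply/eqP.
by rewrite -sqrf_eq0 expr2 h// => i _; rewrite -expr2 sqr_ge0.
Qed.

Lemma dotv_le_enorm u v : dotv u v <= enorm u * enorm v.
Proof.
have d0 z : dotv 0 z = 0 by rewrite -(scale0r 0) dotvZl mul0r.
have [/enorm_eq0->|u0] := eqVneq (enorm u) 0.
  by rewrite d0 mulr_ge0 ?enorm_ge0.
have [/enorm_eq0->|v0] := eqVneq (enorm v) 0.
  by rewrite dotvC d0 mulr_ge0 ?enorm_ge0.
have uv : 0 < enorm u * enorm v.
  by rewrite mulr_gt0// lt_neqAle eq_sym ?u0 ?v0 enorm_ge0.
have := dotvv_ge0 (enorm v *: u - enorm u *: v).
rewrite dotvBl !dotvBr !dotvZl !dotvZr (dotvC v u) -!enorm_sqr.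
have -> : enorm v * (enorm v * enorm u ^+ 2) - enorm v * (enorm u * dotv u v) -
  (enorm u * (enorm v * dotv u v) - enorm u * (enorm u * enorm v ^+ 2)) =
  (enorm u * enorm v) * (2 * (enorm u * enorm v - dotv u v)) by ring.
by rewrite pmulr_rge0// pmulr_rge0// subr_ge0.
Qed.

Lemma ler_enormD u v : enorm (u + v) <= enorm u + enorm v.
Proof.
rewrite -(@ler_pXn2r _ 2)// ?nnegrE ?addr_ge0 ?enorm_ge0//.
rewrite enorm_sqr sqrrD !enorm_sqr dotvDl !dotvDr (dotvC v u).
have := dotv_le_enorm u v; lra.
Qed.

Lemma enormZ k v : enorm (k *: v) = `|k| * enorm v.
Proof. by rewrite /enorm dotvZl dotvZr mulrA -expr2 sqrtrM ?sqr_ge0// sqrtr_sqr. Qed.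

Lemma enormN v : enorm (- v) = enorm v.
Proof. by rewrite -scaleN1r enormZ normrN1 mul1r. Qed.

Lemma enormB u v : enorm (u - v) = enorm (v - u).
Proof. by rewrite -opprB enormN. Qed.

Lemma enorm0 : enorm (0 : 'rV[R]_d) = 0.
Proof. by rewrite -(scale0r 0) enormZ normr0 mul0r. Qed.

Lemma ler_enorm_sum (I : Type) (s : seq I) (F : I -> 'rV[R]_d) :
  enorm (\sum_(i <- s) F i) <= \sum_(i <- s) enorm (F i).
Proof.
elim: s => [|i s IH]; first by rewrite !big_nil enorm0.
by rewrite !big_cons (le_trans (ler_enormD _ _))// lerD2l.
Qed.

Lemma ler_enorm_path (x : nat -> 'rV[R]_d) (i n : nat) : (i <= n)%N ->
  enorm (x n - x i) <= \sum_(i <= j < n) enorm (x j.+1 - x j).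
Proof.
by move=> iln; rewrite -(telescope_sumr x iln) ler_enorm_sum.
Qed.

Lemma dotv_three_points p q z :
  2 * dotv (p - q) (q - z) =
  enorm (p - z) ^+ 2 - enorm (q - z) ^+ 2 - enorm (p - q) ^+ 2.
Proof.
rewrite !enorm_sqr /dotv mulr_sumr -!sumrB; apply: eq_bigr => j _.
by rewrite !mxE; ring.
Qed.

Lemma dotv_quad_ge L u v : 0 < L ->
  - (enorm u ^+ 2 / (2 * L)) <= dotv u v + L / 2 * enorm v ^+ 2.
Proof.
move=> L0; have := dotv_le_enorm (- u) v; rewrite dotvNl enormN => huv.
have L2 : 0 < 2 * L by rewrite mulr_gt0.
rewrite -mulNr ler_pdivrMr//.
have := sqr_ge0 (enorm u - L * enorm v); have : 0 <= L * (enorm u * enorm v + dotv u v).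
  by apply: mulr_ge0; [exact: ltW|lra].
lra.
Qed.

End euclidean.

Section gradient.
Context {R : realType} {d : nat}.
Implicit Types (f : 'rV[R]_d -> R) (x v : 'rV[R]_d).

Lemma derive_grad f x v : differentiable (f : 'rV[R]_d -> R^o) x ->
  'D_v (f : 'rV[R]_d -> R^o) x = dotv (grad f x) v.
Proof.
move=> df; rewrite deriveE// [in LHS](row_sum_delta v) linear_sum/=.
by apply: eq_bigr => j _; rewrite linearZ/= mxE deriveE// mulrC.
Qed.

Lemma is_derive_line f x v (t : R) :
  differentiable (f : 'rV[R]_d -> R^o) (x + t *: v) ->
  is_derive t 1 (fun s => f (x + s *: v) : R^o) (dotv (grad f (x + t *: v)) v).
Proof.
move=> df; have E :
    (fun h : R => h^-1 *: ((((fun s => f (x + s *: v)) : R -> R^o) \o shift t)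
      (h *: 1) - (f (x + t *: v) : R^o))) =
    (fun h : R => h^-1 *: (((f : _ -> R^o) \o shift (x + t *: v)) (h *: v) -
      f (x + t *: v))).
  apply/funext => h /=; congr (_ *: (f _ - _)).
  by rewrite [h *: 1]mulr1 scalerDl addrCA.
split; first by rewrite /derivable E; exact: diff_derivable.
by rewrite -derive_grad// /derive E.
Qed.

Lemma smooth_descent (L : R) f x v : smooth L f ->
  f (x + v) <= f x + dotv (grad f x) v + L / 2 * enorm v ^+ 2.
Proof.
move=> [df Lf].
pose psi (t : R) : R^o := f (x + t *: v) - t * dotv (grad f x) v
  - t ^+ 2 * (L / 2 * enorm v ^+ 2).
pose dpsi (t : R) := dotv (grad f (x + t *: v)) v - dotv (grad f x) v
  - t * (L * enorm v ^+ 2).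
have dpsiP (t : R) : is_derive t 1 (psi : R -> R^o) (dpsi t).
  have := is_derive_line (df (x + t *: v)) => h.
  have -> : psi = (fun s => f (x + s *: v) : R^o) -
     ((dotv (grad f x) v) \*: (id : R -> R^o)) -
     ((L / 2 * enorm v ^+ 2) \*: ((id : R -> R^o) ^+ 2)).
    by apply/funext => s; rewrite /psi !fctE; congr (_ - _ - _); rewrite mulrC.
  apply: is_derive_eq; rewrite /dpsi /= [_ *: 1]mulr1.
  by rewrite /GRing.scale/=; field.
have : psi 1 <= psi 0.
  apply: (@ler0_derive1_nincr _ psi 0 1) => //.
  - move=> t; rewrite in_itv/= => /andP[t0 t1].
    rewrite derive1E (@derive_val _ _ _ _ _ _ _ (dpsiP t)) /dpsi.
    have := dotv_le_enorm (grad f (x + t *: v) - grad f x) v.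
    rewrite dotvBl enormB => h1; have := Lf x (t *: v).
    rewrite enormZ gtr0_norm// => /(ler_wpM2r (enorm_ge0 v)); lra.
  - apply: derivable_within_continuous => t _; have [dpsi_t _] := dpsiP t; exact: dpsi_t.
rewrite /psi scale1r scale0r addr0 expr1n expr0n/=; lra.
Qed.

Lemma convex_grad f (x y : 'rV[R]_d) : convex_function setT f ->
  differentiable (f : 'rV[R]_d -> R^o) x ->
  f x + dotv (grad f x) (y - x) <= f y.
Proof.
move=> cf df; rewrite -lerBrDl -derive_grad//.
have /cvg_dnbhs_at_right dv := diff_derivable (v := y - x) df.
apply: (cvgr_to_le dv); near=> t.
have t0 : 0 < t by near: t; exact: nbhs_right_gt.
have t1 : t < 1 by near: t; exact: nbhs_right_lt.
have h : f (t *: y + (1 - t) *: x) <= t * f y + (1 - t) * f x.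
  exact: (cf (Itv01 (ltW t0) (ltW t1)) y x (in_setT _) (in_setT _)).
rewrite /= [_ *: _]mulrC ler_pdivrMr// lerBlDr.
suff -> : t *: (y - x) + x = t *: y + (1 - t) *: x.
  by rewrite (le_trans h)//; lra.
by rewrite scalerBr scalerBl scale1r -addrA (addrC x).
Unshelve. all: by end_near. Qed.

End gradient.

(** * The step-sizes of the theorem *)

Section stepsizes.
Context {R : realType}.
Variables (L a b c h : R).
Hypothesis L_gt0 : 0 < L.
Hypothesis a01 : 0 < a < 1.
Hypothesis b01 : 0 <= b <= 1.
Hypothesis c_ge0 : 0 <= c.
Hypothesis h_gt0 : 0 < h.

Let a_gt0 : 0 < a. Proof. by case/andP: a01. Qed.
Let a_lt1 : 0 < 1 - a. Proof. by case/andP: a01; rewrite subr_gt0. Qed.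
Let a_ge0 : 0 <= a. Proof. exact: ltW. Qed.
Let a_le1 : 0 <= 1 - a. Proof. exact: ltW. Qed.
Let b_ge0 : 0 <= b. Proof. by case/andP: b01. Qed.
Let b_le1 : b <= 1. Proof. by case/andP: b01. Qed.

Let denom_gt0 (y : R) : 0 < L * (a * y `^ b + c + 1).
Proof.
by rewrite mulr_gt0// ltr_wpDl// addr_ge0// mulr_ge0 ?powR_ge0.
Qed.

Lemma stepsize_gt0 k : 0 < stepsize L a b c h k.
Proof. by rewrite divr_gt0. Qed.

Lemma powR_le_delayed (k t : nat) : k%:R <= t%:R + (a * k%:R `^ b + c) ->
  k%:R `^ b <= ((t%:R + c) / (1 - a)) `^ b.
Proof.
move=> kt; apply: ge0_ler_powR => //; rewrite ?nnegrE// ?divr_ge0// ?addr_ge0//.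
rewrite ler_pdivlMr//; have [->|k0] := posnP k; first by rewrite mul0r addr_ge0.
have : k%:R `^ b <= k%:R by apply: ler1_powR => //; rewrite ler1n.
by move=> /(ler_wpM2l (ltW a_gt0)); lra.
Qed.

Lemma stepsize_window (T k : nat) : T%:R <= Num.min k%:R (a * k%:R `^ b + c) ->
  \sum_((k - T)%N <= t < k.+1) stepsize L a b c h t <= h / L.
Proof.
rewrite le_min ler_nat => /andP[Tk Tle].
set M := a * k%:R `^ b + c + 1.
have M0 : 0 < M by have := denom_gt0 k%:R; rewrite pmulr_rgt0.
apply: (@le_trans _ _ (\sum_((k - T)%N <= t < k.+1) h / (L * M))).
  rewrite !big_nat; apply: ler_sum => t /andP[kTt tk].
  rewrite /stepsize ler_pM2l// lef_pV2 ?posrE ?denom_gt0//.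
  rewrite ler_pM2l// lerD2r lerD2r.
  rewrite ler_pM2l//; apply: powR_le_delayed.
  apply: (@le_trans _ _ (t%:R + T%:R)); last by rewrite lerD2l.
  by rewrite -natrD ler_nat addnC -leq_subLR.
rewrite sumr_const_nat subSn ?leq_subr// subKn// -mulr_natr.
have -> : h / (L * M) * T.+1%:R = h / L * (T.+1%:R / M).
  by field; rewrite !gt_eqF.
apply: ler_piMr; first by rewrite divr_ge0// ltW.
by rewrite ler_pdivrMr// mul1r -natr1 lerD2r.
Qed.

Lemma phiS_le (t : nat) : (0 < t)%N -> phi b t.+1 <= phi b t + t%:R `^ (- b).
Proof.
move=> t0; have tR : 0 < t%:R :> R by rewrite ltr0n.
rewrite /phi; have [->|b1] := eqVneq b 1.
  rewrite powR_inv1// -lerBlDl -ln_div ?posrE ?ltr0n//.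
  have -> : t.+1%:R / t%:R = 1 + t%:R^-1 :> R.
    by rewrite -natr1 mulrDl divff ?gt_eqF// mul1r.
  by apply: le_ln1Dx; rewrite (lt_trans (ltrN10 _))// invr_gt0.
have tE : t.+1%:R = t%:R * (1 + t%:R^-1) :> R.
  by rewrite mulrDr mulr1 divff ?gt_eqF// natr1.
have ti : 0 <= t%:R^-1 :> R by rewrite invr_ge0 ltW.
rewrite tE powRM ?addr_ge0//.
apply: (@le_trans _ _ (t%:R `^ (1 - b) * (1 + t%:R^-1))).
  apply: ler_wpM2l; first exact: powR_ge0.
  by apply: ler1_powR; [rewrite lerDl|rewrite gerBl].
rewrite mulrDr mulr1 lerD2l.
rewrite powRD ?(lt0r_neq0 tR) ?implybT// powRr1 ?(ltW tR)//.
by rewrite mulrAC divff ?gt_eqF// mul1r.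
Qed.

Definition stepsize_scale := h / (L * (a * ((1 + c) / (1 - a)) + c + 1)).

Let kappa := stepsize_scale.

Let kappa_denom_gt0 : 0 < a * ((1 + c) / (1 - a)) + c + 1.
Proof. by rewrite ltr_wpDl// addr_ge0// mulr_ge0// divr_ge0// addr_ge0. Qed.

Lemma stepsize_scale_gt0 : 0 < stepsize_scale.
Proof. by rewrite divr_gt0// mulr_gt0. Qed.

Lemma stepsize_ge (t : nat) : (0 < t)%N ->
  kappa * t%:R `^ (- b) <= stepsize L a b c h t.
Proof.
move=> t0; have tR : 1 <= t%:R :> R by rewrite ler1n.
have tb : 1 <= t%:R `^ b by rewrite -[leLHS](powRr0 t%:R) ler_powR.
have e1 : (t%:R + c) / (1 - a) <= t%:R * ((1 + c) / (1 - a)).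
  rewrite mulrA ler_pM2r ?invr_gt0// mulrDr mulr1 lerD2l ler_peMl//.
have q1 : 1 <= (1 + c) / (1 - a).
  by rewrite ler_pdivlMr// mul1r; move: a_gt0 c_ge0; lra.
have q0 := le_trans ler01 q1.
have s0 : 0 <= (t%:R + c) / (1 - a) by rewrite divr_ge0// addr_ge0.
have e2 : ((t%:R + c) / (1 - a)) `^ b <= t%:R `^ b * ((1 + c) / (1 - a)).
  apply: (@le_trans _ _ ((t%:R * ((1 + c) / (1 - a))) `^ b)).
    by apply: ge0_ler_powR => //; rewrite nnegrE// mulr_ge0.
  rewrite powRM//.
  by apply: ler_wpM2l; [exact: powR_ge0|exact: ler1_powR].
rewrite /kappa /stepsize_scale /stepsize powRN -mulrA -invfM ler_pM2l//.
rewrite lef_pV2 ?posrE ?denom_gt0//; last first.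
  by rewrite mulr_gt0// ?(lt_le_trans _ tb)// mulr_gt0.
rewrite -mulrA ler_pM2l//; move: e2 => /(ler_wpM2l (ltW a_gt0)) e2.
have : c + 1 <= (c + 1) * t%:R `^ b by rewrite ler_peMr// addr_ge0.
lra.
Qed.

Lemma sum_stepsize_ge (n : nat) : (0 < n)%N ->
  kappa * (phi b n - 1) <= \sum_(1 <= t < n) stepsize L a b c h t.
Proof.
have k0 := ltW stepsize_scale_gt0.
elim: n => // -[_ _|n IH _].
  rewrite big_geq// /phi ln1 powR1; case: ifP => _; last by rewrite subrr mulr0.
  by rewrite sub0r mulrN1 oppr_le0.
rewrite big_nat_recr//=; have := IH isT; have := @stepsize_ge n.+1 isT.
have := ler_wpM2l k0 (@phiS_le n.+1 isT); rewrite -/kappa; lra.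
Qed.

Lemma phi_near_ge (A : R) : \forall k \near \oo, A <= phi b k.
Proof.
rewrite /phi; have [_|b1] := eqVneq b 1.
  near=> k; have : expR A <= k%:R by near: k; exact: nbhs_infty_ger.
  move=> Ak; rewrite -[A]expRK ler_ln// posrE ?expR_gt0//.
  exact: lt_le_trans (expR_gt0 _) Ak.
have b1' : 0 < 1 - b by rewrite subr_gt0 lt_neqAle b1.
near=> k; have : Num.max 0 A `^ (1 - b)^-1 <= k%:R by near: k; exact: nbhs_infty_ger.
move=> Ak; apply: (@le_trans _ _ (Num.max 0 A)); first by rewrite le_max lexx orbT.
have A0 : 0 <= Num.max 0 A by rewrite le_max lexx.
rewrite -[leLHS](powRr1 A0) -[X in _ `^ X <= _](mulVf (lt0r_neq0 b1')) powRrM.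
by apply: ge0_ler_powR; rewrite ?nnegrE ?powR_ge0// ltW.
Unshelve. all: by end_near. Qed.

Lemma sum_stepsize_near_ge : \forall n \near \oo,
  [/\ (0 < n)%N, 0 < phi b n &
      kappa / 2 * phi b n <= \sum_(1 <= t < n) stepsize L a b c h t].
Proof.
have k0 := stepsize_scale_gt0.
near=> n; have n0 : (0 < n)%N by near: n; exact: nbhs_infty_gt.
have p2 : 2 <= phi b n by near: n; exact: phi_near_ge.
split => //; first by rewrite (lt_le_trans _ p2).
apply: le_trans (sum_stepsize_ge n0).
rewrite -mulrA ler_pM2l//; lra.
Unshelve. all: by end_near. Qed.

Lemma eqO_inv_phi (u : nat -> R) (C : R) :
  (forall n, (0 < n)%N -> 0 <= u n) ->
  (forall n, (0 < n)%N -> u n * (\sum_(1 <= t < n) stepsize L a b c h t) <= C) ->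
  (fun k => u k : R^o) =O_\oo (fun k => (phi b k)^-1 : R^o).
Proof.
move=> u0 uC; have k0 : 0 < kappa / 2 by rewrite divr_gt0// stepsize_scale_gt0.
apply/eqO_exP; exists ((Num.max 1 C) / (kappa / 2)).
  by rewrite divr_gt0// lt_max ltr01.
apply: filterS sum_stepsize_near_ge => n [n0 p0 hs].
rewrite ger0_norm ?u0// gtr0_norm ?invr_gt0//.
rewrite ler_pdivlMr// ler_pdivlMr// -mulrA (mulrC (phi b n)).
apply: (@le_trans _ _ C); last by rewrite le_max lexx orbT.
by apply: le_trans (uC n n0); apply: ler_wpM2l; rewrite ?u0.
Qed.

Lemma eqO_powR_phi (u : nat -> R) (C delta : R) : 0 < delta ->
  (forall n, (0 < n)%N -> 0 <= u n) ->
  (forall n, (0 < n)%N ->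
     u n <= C * expR (- (delta * \sum_(1 <= t < n) stepsize L a b c h t))) ->
  (fun k => u k : R^o) =O_\oo
    (fun k => expR (- (delta * (kappa / 2))) `^ phi b k : R^o).
Proof.
move=> d0 u0 uC; have k0 : 0 < kappa / 2 by rewrite divr_gt0// stepsize_scale_gt0.
apply/eqO_exP; exists (Num.max 1 C); first by rewrite lt_max ltr01.
apply: filterS sum_stepsize_near_ge => n [n0 p0 hs].
rewrite ger0_norm ?u0// gtr0_norm ?powR_gt0 ?expR_gt0//.
apply: le_trans (uC n n0) _.
apply: (@le_trans _ _ (Num.max 1 C *
    expR (- (delta * \sum_(1 <= t < n) stepsize L a b c h t)))).
  by apply: ler_wpM2r; rewrite ?expR_ge0// le_max lexx orbT.
apply: ler_wpM2l; first by rewrite le_max ler01.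
rewrite /powR gt_eqF ?expR_gt0// ler_expR expRK mulrN lerN2 mulrC -mulrA ler_pM2l//.
Qed.

End stepsizes.

(** * The PIAG iteration *)

Section prox.
Context {R : realType} {d : nat}.
Implicit Types (r : 'rV[R]_d -> \bar R) (x y g : 'rV[R]_d).

Lemma le0_of_le_small (A Q : R) : 0 <= Q ->
  (forall t, 0 < t < 1 -> A <= t * Q) -> A <= 0.
Proof.
move=> Q0 h; rewrite leNgt; apply/negP => A0.
have B0 : 0 < 2 * (A + Q) by rewrite mulr_gt0// ltr_wpDr.
have /h : 0 < A / (2 * (A + Q)) < 1.
  by rewrite divr_gt0//= ltr_pdivrMr//; lra.
rewrite mulrAC ler_pdivlMr//; nra.
Qed.

Lemma prox_subdiff r (gamma : R) x y g z : 0 < gamma -> econvex r ->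
  (forall y, (-oo < r y)%E) -> (r z < +oo)%E ->
  prox (fun y => gamma%:E * r y)%E (x - gamma *: g) y ->
  subdiff r y (gamma^-1 *: (x - y) - g).
Proof.
move=> g0 cvx rNy rz py.
have rzfin : r z \is a fin_num by rewrite fin_real// rNy.
have rfin : r y \is a fin_num.
  rewrite fin_numE gt_eqF ?rNy//=; apply/eqP => ry; have := py z.
  by rewrite ry -(fineK rzfin) gt0_muley ?lte_fin// addye// leye_eq.
split => // w; have [->|rw] := eqVneq (r w) +oo%E; first by rewrite leey.
have rwfin : r w \is a fin_num by rewrite fin_numE gt_eqF ?rNy.
rewrite -(fineK rfin) -(fineK rwfin) -EFinD lee_fin.
set ry := fine (r y); set rW := fine (r w).
set p := x - gamma *: g; set q := enorm (w - y) ^+ 2.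
suff : gamma * (ry - rW) - dotv (y - p) (w - y) <= 0.
  have -> : dotv (y - p) (w - y) = - gamma * dotv (gamma^-1 *: (x - y) - g) (w - y).
    rewrite -dotvZl; congr dotv; rewrite scalerBr scalerA mulNr mulfV ?gt_eqF//.
    by rewrite scaleN1r scaleNr opprK /p !opprB addrA addrAC.
  by rewrite mulNr opprK -mulrDr pmulr_rle0//; lra.
apply: (@le0_of_le_small _ (q / 2)); first by rewrite divr_ge0// sqr_ge0.
move=> t /andP[t0 t1]; pose v := t *: w + (1 - t) *: y.
have := cvx w y t; rewrite -/v (ltW t0) (ltW t1) => /(_ isT).
have /= := py v; rewrite -/p -(fineK rfin) -(fineK rwfin) -/ry -/rW.
have [->|rv] := eqVneq (r v) +oo%E.
  by move=> _; rewrite -!EFinM -EFinD leye_eq.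
have rvfin : r v \is a fin_num by rewrite fin_numE gt_eqF ?rNy.
rewrite -(fineK rvfin) -!EFinM -!EFinD !lee_fin; set rV := fine (r v).
have -> : enorm (v - p) ^+ 2 =
    enorm (y - p) ^+ 2 + 2 * t * dotv (y - p) (w - y) + t ^+ 2 * q.
  rewrite /v /q !enorm_sqr /dotv !mulr_sumr -!big_split/=.
  by apply: eq_bigr => j _; rewrite !mxE; ring.
move=> h1 h2; rewrite -(ler_pM2l t0).
have := ler_wpM2l (ltW g0) h2; lra.
Qed.

Lemma Phat_ge (L : R) (f : 'rV[R]_d -> R) r x xi : 0 < L -> subdiff r x xi ->
  (forall y, (-oo < r y)%E) ->
  ((- (enorm (grad f x + xi) ^+ 2 / (2 * L)))%:E <= Phat L f r x)%E.
Proof.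
move=> L0 [rx sub] rNy; apply: le_ereal_inf_tmp => _ [y _ <-].
have [->|ry] := eqVneq (r y) +oo%E.
  by rewrite -(fineK rx) addey// addye// leey.
have ryfin : r y \is a fin_num by rewrite fin_numE gt_eqF ?rNy.
have := sub y; rewrite -(fineK rx) -(fineK ryfin) -!EFinD !lee_fin => h.
apply: le_trans (dotv_quad_ge (grad f x + xi) (y - x) L0) _.
rewrite dotvDl; lra.
Qed.

End prox.

Section average.
Context {R : realType} {d n : nat}.
Variables (f : 'I_n -> 'rV[R]_d -> R) (Li : 'I_n -> R) (L : R).
Hypothesis f_smooth : forall i, smooth (Li i) (f i).
Hypothesis n_gt0 : (0 < n)%N.
Hypothesis LE : L = Num.sqrt (n%:R^-1 * \sum_(i < n) Li i ^+ 2).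
Hypothesis L_gt0 : 0 < L.

Let n_pos : 0 < n%:R :> R. Proof. by rewrite ltr0n. Qed.

Lemma mean_lipschitz_le : n%:R^-1 * \sum_(i < n) `|Li i| <= L.
Proof.
have S0 : 0 <= n%:R^-1 * \sum_(i < n) Li i ^+ 2.
  by rewrite mulr_ge0 ?invr_ge0 ?sumr_ge0// => i _; exact: sqr_ge0.
have L2 : \sum_(i < n) Li i ^+ 2 = n%:R * L ^+ 2.
  by rewrite LE sqr_sqrtr// mulrA mulfV ?mul1r// gt_eqF.
rewrite mulrC ler_pdivrMr// -(ler_pM2l (_ : 0 < 2 * L)) ?mulr_gt0//.
apply: (@le_trans _ _ (\sum_(i < n) (Li i ^+ 2 + L ^+ 2))).
  rewrite mulr_sumr; apply: ler_sum => i _.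
  by have := sqr_ge0 (`|Li i| - L); rewrite -(real_normK (num_real (Li i))); lra.
by rewrite big_split/= L2 sumr_const card_ord -mulr_natl; lra.
Qed.

Lemma grad_favg x : grad (favg f) x = n%:R^-1 *: \sum_(i < n) grad (f i) x.
Proof.
apply/rowP => j; rewrite !mxE summxE.
have -> : (favg f : 'rV[R]_d -> R^o) =
    n%:R^-1 \*: \sum_(i < n) (f i : 'rV[R]_d -> R^o).
  by apply/funext => y; rewrite /favg /= fct_sumE.
have df i : derivable (f i : 'rV[R]_d -> R^o) x (delta_mx 0 j).
  by have [/(_ x) dfi _] := f_smooth i; exact: diff_derivable.
rewrite deriveZ; last exact: derivable_sum.
by rewrite derive_sum//; congr (_ * _); apply: eq_bigr => i _; rewrite mxE.
Qed.

Lemma smooth_norm i : smooth `|Li i| (f i).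
Proof.
have [df Lf] := f_smooth i; split => // x v; apply: le_trans (Lf x v) _.
by apply: ler_wpM2r; rewrite ?enorm_ge0// ler_norm.
Qed.

Lemma mean_grad_sub_le (x y : 'I_n -> 'rV[R]_d) (e : R) :
  (forall i, enorm (y i - x i) <= e) -> 0 <= e ->
  enorm (n%:R^-1 *: \sum_(i < n) grad (f i) (x i) -
         n%:R^-1 *: \sum_(i < n) grad (f i) (y i)) <= L * e.
Proof.
move=> xy e0; rewrite -scalerBr -sumrB enormZ ger0_norm ?invr_ge0//.
apply: (@le_trans _ _ (n%:R^-1 * (\sum_(i < n) `|Li i|) * e)); last first.
  by apply: ler_wpM2r => //; exact: mean_lipschitz_le.
rewrite -mulrA; apply: ler_wpM2l; first by rewrite invr_ge0.
apply: le_trans (ler_enorm_sum _ _) _; rewrite mulr_suml; apply: ler_sum => i _.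
have [_ /(_ (x i) (y i - x i))] := smooth_norm i.
rewrite (addrC (x i)) subrK => /le_trans; apply; exact: ler_wpM2l.
Qed.

Lemma mean_descent (x v : 'I_n -> 'rV[R]_d) (e : R) :
  (forall i, enorm (v i) <= e) -> 0 <= e ->
  n%:R^-1 * (\sum_(i < n) f i (x i + v i)) <=
  n%:R^-1 * (\sum_(i < n) (f i (x i) + dotv (grad (f i) (x i)) (v i)))
  + L / 2 * e ^+ 2.
Proof.
move=> ve e0.
apply: (@le_trans _ _ (n%:R^-1 *
    (\sum_(i < n) (f i (x i) + dotv (grad (f i) (x i)) (v i)) +
     \sum_(i < n) `|Li i| * (e ^+ 2 / 2)))).
  apply: ler_wpM2l; first by rewrite invr_ge0.
  rewrite -big_split; apply: ler_sum => i _ /=.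
  apply: le_trans (smooth_descent _ _ (smooth_norm i)) _.
  rewrite lerD2l -mulrA; apply: ler_wpM2l => //.
  rewrite mulrC ler_pM2r//.
  by rewrite ler_pXn2r// nnegrE// enorm_ge0.
rewrite mulrDr lerD2l -mulr_suml mulrA.
have := ler_wpM2r (_ : 0 <= e ^+ 2 / 2) mean_lipschitz_le.
rewrite divr_ge0 ?sqr_ge0// => /(_ isT); lra.
Qed.

Lemma favg_descent x v :
  favg f (x + v) <= favg f x + dotv (grad (favg f) x) v + L / 2 * enorm v ^+ 2.
Proof.
have := @mean_descent (fun=> x) (fun=> v) _ (fun=> lexx _) (enorm_ge0 v).
by rewrite big_split/= mulrDr grad_favg dotvZl dotv_suml.
Qed.

End average.

Section piag.
Context {R : realType} {d n : nat}.
Variables (f : 'I_n -> 'rV[R]_d -> R) (r : 'rV[R]_d -> \bar R).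
Variables (Li : 'I_n -> R) (L h Pstar : R) (xstar : 'rV[R]_d).
Variables (tau : 'I_n -> nat -> nat) (gamma : nat -> R) (x : nat -> 'rV[R]_d).
Hypothesis n_gt0 : (0 < n)%N.
Hypothesis f_smooth : forall i, smooth (Li i) (f i).
Hypothesis r_gtNy : forall y, (-oo < r y)%E.
Hypothesis r_convex : econvex r.
Hypothesis xstar_min : argmin (fun y => (favg f y)%:E + r y)%E xstar.
Hypothesis xstarE : ((favg f xstar)%:E + r xstar)%E = Pstar%:E.
Hypothesis LE : L = Num.sqrt (n%:R^-1 * \sum_(i < n) Li i ^+ 2).
Hypothesis L_gt0 : 0 < L.
Hypothesis h01 : 0 < h < 1.
Hypothesis gamma_gt0 : forall k, 0 < gamma k.
Hypothesis window : forall k,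
  \sum_((k - \max_(i < n) tau i k)%N <= t < k.+1) gamma t <= h / L.
Hypothesis x_PIAG : PIAG f r tau gamma x.

Let H := h / L.
Let m k := (k - \max_(i < n) tau i k)%N.
Let s k := enorm (x k.+1 - x k).
Let w k := s k ^+ 2 / gamma k.
Let S k := \sum_(m k <= j < k) s j.
Let W k := \sum_(m k <= j < k) w j.
Let g k := aggr_grad f tau x k.
Let F k := fine ((favg f (x k))%:E + r (x k) - Pstar%:E)%E.

Definition prox_residual k : 'rV[R]_d :=
  (gamma k.-1)^-1 *: (x k.-1 - x k) - aggr_grad f tau x k.-1.

Let xi := prox_residual.
Let G k := enorm (grad (favg f) (x k) + xi k) ^+ 2.

Let m_le k : (m k <= k)%N. Proof. exact: leq_subr. Qed.

Let s_ge0 k : 0 <= s k. Proof. exact: enorm_ge0. Qed.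

Let S_ge0 k : 0 <= S k. Proof. by apply: sumr_ge0. Qed.

Let w_ge0 k : 0 <= w k.
Proof. by rewrite divr_ge0 ?sqr_ge0// ltW. Qed.

Let W_ge0 k : 0 <= W k. Proof. by apply: sumr_ge0. Qed.

Let LH : L * H = h. Proof. by rewrite /H mulrC divfK// gt_eqF. Qed.

Let L_ge0 : 0 <= L. Proof. exact: ltW. Qed.

Let H_ge0 : 0 <= H.
Proof. by case/andP: h01 => h0 _; rewrite divr_ge0// ltW. Qed.

Let gammaH k : gamma k <= H.
Proof. exact: (window_step_le gamma_gt0 m_le window). Qed.

Let r_xstar : r xstar = (Pstar - favg f xstar)%:E.
Proof.
move: xstarE; have := r_gtNy xstar; case: (r xstar) => // t _.
by rewrite -EFinD => -[<-]; rewrite addrAC subrr add0r.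
Qed.

Lemma prox_residual_subdiff k : (0 < k)%N -> subdiff r (x k) (prox_residual k).
Proof.
case: k => // k _; apply: (prox_subdiff (z := xstar)) => //.
by rewrite r_xstar ltry.
Qed.

Let rE k : (0 < k)%N -> r (x k) = (F k + Pstar - favg f (x k))%:E.
Proof.
move=> k0; have [rx _] := prox_residual_subdiff k0.
by rewrite /F -(fineK rx)/=; congr (_%:E); ring.
Qed.

Lemma suboptimality_fin k : (0 < k)%N ->
  ((favg f (x k))%:E + r (x k) - Pstar%:E)%E = (F k)%:E.
Proof.
by move=> k0; rewrite rE//=; congr (_%:E); ring.
Qed.

Let F_ge0 k : (0 < k)%N -> 0 <= F k.
Proof.
move=> k0; have := xstar_min (x k); rewrite xstarE rE// -EFinD lee_fin; lra.
Qed.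

Let r_le k y ry : (0 < k)%N -> r y = ry%:E ->
  F k + Pstar - favg f (x k) + dotv (xi k) (y - x k) <= ry.
Proof.
move=> k0 yE; have [_ /(_ y)] := prox_residual_subdiff k0.
by rewrite rE// yE -EFinD lee_fin.
Qed.

Let xiE k v : dotv (xi k.+1) v =
  (gamma k)^-1 * dotv (x k - x k.+1) v - dotv (g k) v.
Proof. by rewrite /xi /prox_residual [LHS]dotvBl dotvZl. Qed.

Let delayed_le i k : enorm (x k - x (k - tau i k)%N) <= S k.
Proof.
apply: le_trans (ler_enorm_path _ (leq_subr _ _)) _.
have mt : (m k <= k - tau i k)%N.
  by apply: leq_sub2l; exact: (leq_bigmax (F := fun i => tau i k)).
by rewrite /S (big_cat_nat mt (leq_subr _ _))/= lerDr sumr_ge0.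
Qed.

Let grad_error_le k : enorm (grad (favg f) (x k) - g k) <= L * S k.
Proof.
rewrite (grad_favg f_smooth) enormB.
by apply: (mean_grad_sub_le f_smooth n_gt0 LE L_gt0) => // i; exact: delayed_le.
Qed.

Let descent k : (0 < k)%N ->
  F k.+1 <= F k + L * (S k * s k) + L / 2 * s k ^+ 2 - w k.
Proof.
move=> k0; have := r_le (ltn0Sn k) (rE k0).
have := favg_descent f_smooth n_gt0 LE L_gt0 (x k) (x k.+1 - x k).
rewrite (addrC (x k)) subrK -/(s k) xiE.
have -> : (gamma k)^-1 * dotv (x k - x k.+1) (x k - x k.+1) = w k.
  by rewrite -enorm_sqr enormB mulrC.
have -> : dotv (g k) (x k - x k.+1) = - dotv (g k) (x k.+1 - x k).
  by rewrite -opprB dotvNr.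
have := dotv_le_enorm (grad (favg f) (x k) - g k) (x k.+1 - x k).
rewrite dotvBl -/(s k).
have := ler_wpM2r (s_ge0 k) (grad_error_le k).
lra.
Qed.

Let stationarity k : gamma k * G k.+1 <=
  (2 * L ^+ 2 * H ^+ 2 + 2) * w k + (2 * L ^+ 2 * H) * (gamma k * W k).
Proof.
have g0 := gamma_gt0 k.
have GE : G k.+1 <= 2 * L ^+ 2 * (S k + s k) ^+ 2 + 2 * (s k / gamma k) ^+ 2.
  have : enorm (grad (favg f) (x k.+1) + xi k.+1) <=
      L * (S k + s k) + s k / gamma k.
    have -> : grad (favg f) (x k.+1) + xi k.+1 =
        (grad (favg f) (x k.+1) - grad (favg f) (x k)) +
        (grad (favg f) (x k) - g k) + (gamma k)^-1 *: (x k - x k.+1).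
      by rewrite [in RHS]addrA subrK /xi /prox_residual/= -/(g k) addrA addrAC.
    apply: le_trans (ler_enormD _ _) _; apply: lerD; last first.
      by rewrite enormZ gtr0_norm ?invr_gt0// mulrC enormB.
    apply: le_trans (ler_enormD _ _) _; rewrite mulrDr addrC; apply: lerD => //.
    rewrite !(grad_favg f_smooth) -/(s k).
    by apply: (mean_grad_sub_le f_smooth n_gt0 LE L_gt0) => // i; rewrite enormB.
  have e0 := enorm_ge0 (grad (favg f) (x k.+1) + xi k.+1).
  move=> hle; apply: (@le_trans _ _ ((L * (S k + s k) + s k / gamma k) ^+ 2)).
    by rewrite /G ler_pXn2r// nnegrE// (le_trans e0).
  by have := sqr_ge0 (L * (S k + s k) - s k / gamma k); lra.
have := ler_wpM2l (ltW g0) GE; rewrite mulrDr.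
have -> : gamma k * (2 * (s k / gamma k) ^+ 2) = 2 * w k.
  by rewrite /w; field; rewrite gt_eqF.
move=> /le_trans; apply.
have := window_sqrS_le s gamma_gt0 m_le window k.
rewrite -/(S k) -/(w k) -/(W k) -/H => hw.
have : gamma k * L ^+ 2 * (S k + s k) ^+ 2 <= gamma k * L ^+ 2 * (H * (W k + w k)).
  by apply: ler_wpM2l hw; rewrite mulr_ge0 ?sqr_ge0// ltW.
have : L ^+ 2 * H * w k * gamma k <= L ^+ 2 * H * w k * H.
  by apply: ler_wpM2l => //; rewrite mulr_ge0// mulr_ge0// sqr_ge0.
lra.
Qed.

Let c1 := 2 * L ^+ 2 * H ^+ 2 + 2.
Let c2 := 2 * L ^+ 2 * H.

Let c1_ge0 : 0 <= c1.
Proof. by rewrite addr_ge0// mulr_ge0 ?sqr_ge0// mulr_ge0 ?sqr_ge0. Qed.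

Let c2_ge0 : 0 <= c2.
Proof. by rewrite mulr_ge0// mulr_ge0 ?sqr_ge0. Qed.

Lemma PIAG_stationarity : exists2 C : R, 0 <= C & forall N mu, (0 < N)%N ->
  (forall t, (0 < t <= N)%N ->
     mu <= enorm (grad (favg f) (x t) + prox_residual t) ^+ 2) ->
  mu * (\sum_(1 <= t < N) gamma t) <= C.
Proof.
apply: (best_iterate_rate gamma_gt0 m_le window L_gt0 h01 LH F_ge0 descent
  (G := G) c1_ge0 c2_ge0).
by move=> k _; exact: stationarity.
Qed.

Lemma PIAG_convex : (forall i, convex_function setT (f i)) ->
  exists2 C : R, 0 <= C & forall N, (0 < N)%N ->
    F N * (\sum_(1 <= t < N) gamma t) <= C.
Proof.
move=> cvx.
apply: (last_iterate_rate gamma_gt0 m_le window L_gt0 h01 LH F_ge0 descent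
  (D := fun k => enorm (x k - xstar) ^+ 2 / 2)
  (c1 := L / 2 * H * H) (c2 := L / 2 * H)).
- by rewrite mulr_ge0// mulr_ge0// divr_ge0.
- by rewrite mulr_ge0// divr_ge0.
- by move=> k; rewrite divr_ge0// sqr_ge0.
move=> k k0; have g0 := gamma_gt0 k.
set e := S k + s k; pose y i := x (k - tau i k)%N.
have fle : favg f (x k.+1) <= favg f xstar + dotv (g k) (x k.+1 - xstar) + L / 2 * e ^+ 2.
  have := @mean_descent _ _ _ f _ L f_smooth n_gt0 LE L_gt0 y (fun i => x k.+1 - y i) e.
  have ye i : enorm (x k.+1 - y i) <= e.
    rewrite -(subrK (x k) (x k.+1)) -addrA; apply: le_trans (ler_enormD _ _) _.
    by rewrite /e [leRHS]addrC; apply: lerD => //; exact: delayed_le.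
  rewrite addr_ge0// => /(_ ye isT).
  under eq_bigr do rewrite addrC subrK.
  rewrite -/(favg f (x k.+1)) => /le_trans; apply; rewrite lerD2r.
  rewrite /g /aggr_grad dotvZl dotv_suml /favg -mulrDr -big_split/=.
  apply: ler_wpM2l; first by rewrite invr_ge0.
  apply: ler_sum => i _; have [/(_ (y i)) df _] := f_smooth i.
  have := convex_grad xstar (cvx i) df; rewrite !dotvBr -/(y i); lra.
have := r_le (ltn0Sn k) r_xstar; rewrite xiE.
have := dotv_three_points (x k) (x k.+1) xstar.
have -> : dotv (g k) (xstar - x k.+1) = - dotv (g k) (x k.+1 - xstar).
  by rewrite -(opprB (x k.+1) xstar) dotvNr.
have -> : dotv (x k - x k.+1) (xstar - x k.+1) = - dotv (x k - x k.+1) (x k.+1 - xstar).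
  by rewrite -(opprB (x k.+1) xstar) dotvNr.
set D := dotv (x k - _) _; rewrite mulrN => D3 hF.
have F1 : F k.+1 <= (gamma k)^-1 * D + L / 2 * e ^+ 2 by lra.
have := ler_wpM2l (ltW g0) F1; rewrite mulrDr mulVKf ?gt_eqF// => /le_trans; apply.
have := window_sqrS_le s gamma_gt0 m_le window k.
rewrite -/(S k) -/(w k) -/(W k) -/H -/e => hw.
have : gamma k * (L / 2) * e ^+ 2 <= gamma k * (L / 2) * (H * (W k + w k)).
  by apply: ler_wpM2l hw; rewrite mulr_ge0 ?divr_ge0// ltW.
have : L / 2 * H * w k * gamma k <= L / 2 * H * w k * H.
  by apply: ler_wpM2l => //; rewrite mulr_ge0// mulr_ge0// divr_ge0.
have := sqr_ge0 (enorm (x k - x k.+1)).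
lra.
Qed.

Lemma PIAG_proxPL sigma : 0 < sigma -> proxPL sigma L (favg f) r Pstar ->
  exists2 C : R, 0 <= C & exists2 delta : R, 0 < delta & forall N, (0 < N)%N ->
    F N <= C * expR (- (delta * \sum_(1 <= t < N) gamma t)).
Proof.
move=> s0 PL; have s2 : 0 < 2 * sigma by rewrite mulr_gt0.
apply: (last_iterate_linear_rate gamma_gt0 m_le window L_gt0 h01 LH F_ge0 descent
  (c1 := c1 / (2 * sigma)) (c2 := c2 / (2 * sigma))).
- by rewrite divr_ge0// ltW.
- by rewrite divr_ge0// ltW.
move=> k k0; have FG : sigma * F k.+1 <= G k.+1 / 2.
  have := PL (x k.+1); rewrite suboptimality_fin// rE// -EFinD ltry -EFinM => /(_ isT) h1.
  have h2 := Phat_ge (favg f) L_gt0 (prox_residual_subdiff (ltn0Sn k)) r_gtNy.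
  rewrite -lee_fin; apply: le_trans h1 _.
  have -> : (G k.+1 / 2)%:E = (- (L%:E * (- (G k.+1 / (2 * L)))%:E))%E.
    by rewrite -EFinM -EFinN; congr (_%:E); field; rewrite gt_eqF.
  by rewrite leeN2; apply: lee_wpmul2l; rewrite ?lee_fin.
rewrite -/(w k) -/(W k).
have -> : c1 / (2 * sigma) * w k + c2 / (2 * sigma) * (gamma k * W k) =
    (c1 * w k + c2 * (gamma k * W k)) / (2 * sigma) by field; rewrite gt_eqF.
rewrite ler_pdivlMr//.
have := stationarity k; rewrite -/c1 -/c2.
have := ler_wpM2l (ltW (gamma_gt0 k)) FG; lra.
Qed.

End piag.

Lemma min_upto_le (R : realType) (F : nat -> R) (k t : nat) :
  (0 < t <= k)%N -> min_upto F k <= F t.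
Proof.
move=> /andP[t0 tk]; rewrite /min_upto.
by apply: bigmin_inf_seq (lexx _) => //; rewrite mem_index_iota t0 ltnS.
Qed.

Lemma min_upto_ge0 (R : realType) (F : nat -> R) (k : nat) :
  (forall t, 0 <= F t) -> 0 <= min_upto F k.
Proof.
move=> F0; rewrite /min_upto; elim/big_rec: _ => // i y _ y0.
by rewrite le_min F0.
Qed.

Theorem theorem1 (R : realType) (d n : nat) (n_gt0 : (0 < n)%N)
    (f : 'I_n -> 'rV[R]_d -> R) (r : 'rV[R]_d -> \bar R)
    (Li : 'I_n -> R) (L Pstar a b c h : R)
    (tau : 'I_n -> nat -> nat) (x : nat -> 'rV[R]_d)
    (P := fun y => ((favg f y)%:E + r y)%E)
    (f_smooth : forall i, smooth (Li i) (f i))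
    (r_gtNy : forall y, (-oo < r y)%E)
    (r_convex : econvex r)
    (r_closed : eclosed r)
    (PstarP : exists2 xstar, argmin P xstar & P xstar = Pstar%:E)
    (a01 : 0 < a < 1) (b01 : 0 <= b <= 1) (c_ge0 : 0 <= c)
    (tau_le : forall k : nat,
      (\max_(i < n) tau i k)%:R <= Num.min k%:R (a * k%:R `^ b + c))
    (LE : L = Num.sqrt (n%:R^-1 * \sum_(i < n) Li i ^+ 2))
    (L_gt0 : 0 < L)
    (h01 : 0 < h < 1)
    (x_PIAG : PIAG f r tau (stepsize L a b c h) x) :
  [/\ exists xi : nat -> 'rV[R]_d,
        [/\ forall k : nat, (0 < k)%N -> subdiff r (x k) (xi k),
            subdiff r (x 0%N) !=set0 -> subdiff r (x 0%N) (xi 0%N) &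
            (fun k => min_upto
               (fun t => enorm (grad (favg f) (x t) + xi t) ^+ 2) k : R^o)
            =O_\oo (fun k => (phi b k)^-1 : R^o)],
      (forall i, convex_function setT (f i)) ->
        ebigO (fun k => P (x k) - Pstar%:E)%E (fun k => (phi b k)^-1) &
      forall sigma : R, 0 < sigma ->
        proxPL sigma L (favg f) r Pstar ->
        exists2 lambda : R, 0 < lambda < 1 &
          ebigO (fun k => P (x k) - Pstar%:E)%E (fun k => lambda `^ phi b k)].
Proof.
have [a0 a1] := andP a01; have [h0 h1] := andP h01.
have [xstar xmin xE] := PstarP.
have g0 k : 0 < stepsize L a b c h k by exact: stepsize_gt0.
have win k : \sum_((k - \max_(i < n) tau i k)%N <= t < k.+1)
    stepsize L a b c h t <= h / L by exact: stepsize_window.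
pose F k := fine ((favg f (x k))%:E + r (x k) - Pstar%:E)%E.
have FE k : (0 < k)%N -> ((favg f (x k))%:E + r (x k) - Pstar%:E)%E = (F k)%:E.
  exact: (suboptimality_fin r_gtNy r_convex xE g0 x_PIAG).
have F0 k : (0 < k)%N -> 0 <= F k.
  by move=> k0; rewrite -lee_fin -FE// sube_ge0// -xE; exact: xmin.
have Ffin : \forall k \near \oo, (P (x k) - Pstar%:E)%E \is a fin_num.
  near=> k; rewrite /P FE//; near: k; exact: nbhs_infty_gt.
split.
- pose xi0 := if pselect (subdiff r (x 0%N) !=set0) is left e then sval (cid e) else 0.
  exists (fun k => if k is 0%N then xi0 else
    prox_residual f tau (stepsize L a b c h) x k); split.
  + move=> [//|k] _.
    exact: (prox_residual_subdiff r_gtNy r_convex xE g0 x_PIAG).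
  + by move=> e; rewrite /xi0; case: pselect => // e'; case: cid.
  have [C C0 hC] := PIAG_stationarity n_gt0 f_smooth r_gtNy r_convex xmin xE LE
    L_gt0 h01 g0 win x_PIAG.
  apply: (@eqO_inv_phi R L a b c h _ _ _ _ _ _ C) => //.
    by move=> N _; apply: min_upto_ge0 => t; exact: sqr_ge0.
  move=> N N0; apply: hC => // t /andP[t0 tN].
  apply: le_trans (min_upto_le _ (_ : (0 < t <= N)%N)) _; first by rewrite t0.
  by case: t t0 tN.
- move=> cvx.
  have [C C0 hC] := PIAG_convex n_gt0 f_smooth r_gtNy r_convex xmin xE LE
    L_gt0 h01 g0 win x_PIAG cvx.
  by split => //; exact: (@eqO_inv_phi R L a b c h _ _ _ _ _ _ C).
- move=> sigma sigma0 PL.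
  have [C C0 [delta d0 hC]] := PIAG_proxPL n_gt0 f_smooth r_gtNy r_convex xmin xE
    LE L_gt0 h01 g0 win x_PIAG sigma0 PL.
  exists (expR (- (delta * (stepsize_scale L a c h / 2)))).
    rewrite expR_gt0/= expR_lt1 oppr_lt0 mulr_gt0// divr_gt0//.
    exact: stepsize_scale_gt0.
  by split => //; exact: (@eqO_powR_phi R L a b c h _ _ _ _ _ _ C).
Unshelve. all: by end_near. Qed.
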